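(* Let $q$ and $k$ be fixed natural numbers. For all $n$ such that $n\ge qk$, $$u_{q,k}(n)=\binom{n-qk+k-1}{k-1};$$ otherwise $n<qk$ and $u_{q,k}(n)=0$. Furthermore, the generating function for $u_{q,k}(n)$ is, as a formal power series in $x$, $$\sum_{n=qk}^{\infty}u_{q,k}(n)x^n=\frac{x^{qk}}{\left(1-x\right)^{k}}.$$
   Context: Natural numbers are positive integers, and $n$ ranges over natural numbers. A composition of $n$ into exactly $k$ parts is an ordered sequence $(a_1,\dots,a_k)$ of natural numbers (called its parts) with $n=a_1+a_2+\cdots+a_k$; sequences differing in order are different compositions. $u_{q,k}(n)$ denotes the number of compositions of $n$ into exactly $k$ parts, all of which are greater than or equal to $q$. *)

(* Defs.v *)
From HB Require Import structures.
From mathcomp Require Import all_boot all_order all_algebra.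
From mathcomp Require Import boolp.

Set Implicit Arguments.
Unset Strict Implicit.
Unset Printing Implicit Defensive.

Import GRing.Theory.

Definition is_composition (n k : nat) (s : seq nat) : bool :=
  [&& size s == k, all (leq 1) s & sumn s == n].

(* A part of a composition of n is at most n, so bounding the entries of the
   tuples by n loses no composition; see [num_compositions_geP]. *)
Definition num_compositions_ge (q k n : nat) : nat :=
  #|[set t : k.-tuple 'I_n.+1 |
      is_composition n k (map val t) && all (leq q) (map val t)]|.

Lemma num_compositions_geP (q k n : nat) :
  exists l : seq (seq nat),
    [/\ uniq l,
        forall s, (s \in l) = is_composition n k s && all (leq q) s
      & num_compositions_ge q k n = size l].
Proof.
set A := [set t : k.-tuple 'I_n.+1 |
  is_composition n k (map val t) && all (leq q) (map val t)].
exists [seq map val (tval t) | t <- enum A]; split.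
- rewrite map_inj_uniq ?enum_uniq // => t1 t2 /(inj_map val_inj) ?.
  exact: val_inj.
- move=> s; apply/mapP/idP => [[t]|Hs].
    by rewrite mem_enum inE => Ht ->.
  have /andP[/and3P[/eqP szs _ /eqP sums] _] := Hs.
  have le_s x : x \in s -> x <= n.
    move=> /[dup] /(nthP 0)[i ilt <-] _; rewrite -sums sumnE (big_nth 0).
    by rewrite big_mkord (bigD1 (Ordinal ilt)) //= leq_addr.
  have sE : map val (map (@inord n) s) = s.
    rewrite -map_comp -[RHS]map_id; apply/eq_in_map => x xs /=.
    by rewrite inordK // ltnS le_s.
  have sz : size (map (@inord n) s) == k by rewrite size_map szs.
  by exists (Tuple sz); rewrite ?mem_enum ?inE /= sE.
- by rewrite size_map -cardE.
Qed.

Local Open Scope ring_scope.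

Record fps (R : Type) := Fps { fcoef : nat -> R }.

Notation "{ 'fps' R }" := (fps R) (at level 0, format "{ 'fps'  R }").

Lemma fpsP (R : Type) (a b : {fps R}) : fcoef a =1 fcoef b <-> a = b.
Proof.
split=> [|-> //]; case: a b => [a] [b] /= E; congr Fps.
exact: functional_extensionality_dep.
Qed.

HB.instance Definition _ (R : Type) := gen_eqMixin {fps R}.
HB.instance Definition _ (R : Type) := gen_choiceMixin {fps R}.

Section FpsZmodule.
Variable R : zmodType.
Implicit Types a b c : {fps R}.

Definition fps_zero : {fps R} := Fps (fun=> 0).
Definition fps_opp a : {fps R} := Fps (fun n => - fcoef a n).
Definition fps_add a b : {fps R} := Fps (fun n => fcoef a n + fcoef b n).

Fact fps_addA : associative fps_add.
Proof. by move=> a b c; apply/fpsP => n /=; rewrite addrA. Qed.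
Fact fps_addC : commutative fps_add.
Proof. by move=> a b; apply/fpsP => n /=; rewrite addrC. Qed.
Fact fps_add0 : left_id fps_zero fps_add.
Proof. by move=> a; apply/fpsP => n /=; rewrite add0r. Qed.
Fact fps_addN : left_inverse fps_zero fps_opp fps_add.
Proof. by move=> a; apply/fpsP => n /=; rewrite addNr. Qed.

HB.instance Definition _ :=
  GRing.isZmodule.Build {fps R} fps_addA fps_addC fps_add0 fps_addN.

Lemma fcoef0 n : fcoef (0 : {fps R}) n = 0. Proof. by []. Qed.
Lemma fcoefN a n : fcoef (- a) n = - fcoef a n. Proof. by []. Qed.
Lemma fcoefD a b n : fcoef (a + b) n = fcoef a n + fcoef b n.
Proof. by []. Qed.
Lemma fcoefB a b n : fcoef (a - b) n = fcoef a n - fcoef b n.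
Proof. by []. Qed.
Lemma fcoef_sum (I : Type) (r : seq I) (P : pred I) (F : I -> {fps R}) n :
  fcoef (\sum_(i <- r | P i) F i) n = \sum_(i <- r | P i) fcoef (F i) n.
Proof. by elim/big_rec2: _ => // i x y _ <-. Qed.

End FpsZmodule.

Section FpsRing.
Variable R : comNzRingType.
Implicit Types a b c : {fps R}.

Definition fps_one : {fps R} := Fps (fun n => (n == 0)%:R).
Definition fps_mul a b : {fps R} :=
  Fps (fun n => \sum_(i < n.+1) fcoef a i * fcoef b (n - i)).

Fact fps_mulC : commutative fps_mul.
Proof.
move=> a b; apply/fpsP => n /=; rewrite (reindex_inj rev_ord_inj) /=.
by apply: eq_bigr => i _; rewrite subSS subKn -1?ltnS // mulrC.
Qed.
Fact fps_mul1 : left_id fps_one fps_mul.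
Proof.
move=> a; apply/fpsP => n /=; rewrite big_ord_recl /= mul1r subn0.
by rewrite big1 ?addr0 // => i _; rewrite mul0r.
Qed.
Fact fps_mulDl : left_distributive fps_mul +%R.
Proof.
move=> a b c; apply/fpsP => n; rewrite fcoefD /= -big_split.
by apply: eq_bigr => i _ /=; rewrite mulrDl.
Qed.

Let trunc N a : {poly R} := \poly_(i < N.+1) fcoef a i.
Let mul_trunc N a b n : (n <= N)%N ->
  fcoef (fps_mul a b) n = (trunc N a * trunc N b)`_n.
Proof.
move=> leN; rewrite coefM /=; apply: eq_bigr => i _.
have lei : (i <= n)%N by rewrite -ltnS.
by rewrite !coef_poly !ltnS (leq_trans lei leN) (leq_trans (leq_subr i n) leN).
Qed.

Fact fps_mulA : associative fps_mul.
Proof.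
move=> a b c; apply/fpsP => n.
transitivity ((trunc n a * (trunc n b * trunc n c))`_n).
  rewrite coefM /=; apply: eq_bigr => i _; rewrite coef_poly ltn_ord.
  by congr (_ * _); rewrite -mul_trunc ?leq_subr.
rewrite mulrA coefM /=; apply: eq_bigr => i _.
rewrite coef_poly ltnS leq_subr; congr (_ * _).
by rewrite -mul_trunc // -ltnS.
Qed.
Fact fps_one_neq0 : fps_one != 0.
Proof.
by apply/eqP => /fpsP/(_ 0%N)/eqP; rewrite fcoef0 oner_eq0.
Qed.

HB.instance Definition _ := GRing.Zmodule_isComNzRing.Build {fps R}
  fps_mulA fps_mulC fps_mul1 fps_mulDl fps_one_neq0.

Definition fpsX : {fps R} := Fps (fun n => (n == 1)%:R).

Lemma fcoef1 n : fcoef (1 : {fps R}) n = (n == 0)%:R. Proof. by []. Qed.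
Lemma fcoefX n : fcoef fpsX n = (n == 1)%:R. Proof. by []. Qed.
Lemma fcoefM a b n :
  fcoef (a * b) n = \sum_(i < n.+1) fcoef a i * fcoef b (n - i).
Proof. by []. Qed.

Lemma fcoef0M a b : fcoef (a * b) 0 = fcoef a 0 * fcoef b 0.
Proof. by rewrite fcoefM big_ord1. Qed.

Lemma fcoefXM a n :
  fcoef (fpsX * a) n = if n is n'.+1 then fcoef a n' else 0.
Proof.
rewrite fcoefM; case: n => [|n]; first by rewrite big_ord1 mul0r.
rewrite !big_ord_recl /= mul0r add0r mul1r subn1 /= big1 ?addr0 // => i _.
by rewrite mul0r.
Qed.

Lemma fcoefXn k n : fcoef (fpsX ^+ k) n = (n == k)%:R.
Proof.
by elim: k n => [|k IHk] [|n] //; rewrite exprS fcoefXM ?IHk.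
Qed.

(* The formal infinite sum of the terms (c n) x^n over n >= m; see
   [fcoef_fps_sum_from]. *)
Definition fps_sum_from (m : nat) (c : nat -> R) : {fps R} :=
  Fps (fun n => if (m <= n)%N then c n else 0).

Lemma fcoef_fps_sum_from (m : nat) (c : nat -> R) (n N : nat) : (n < N)%N ->
  fcoef (fps_sum_from m c) n =
  fcoef (\sum_(m <= i < N) Fps (fun j => (j == 0)%:R * c i) * fpsX ^+ i) n.
Proof.
move=> ltnN; rewrite fcoef_sum.
have E i : fcoef (Fps (fun j => (j == 0)%:R * c i) * fpsX ^+ i) n =
           if n == i then c i else 0.
  rewrite fcoefM big_ord_recl /= subn0 fcoefXn mul1r big1 ?addr0 => [|j _].
    by case: eqP => _; rewrite ?mulr1 ?mulr0.
  by rewrite !mul0r.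
rewrite (eq_bigr _ (fun i _ => E i)) -big_mkcond /=.
case: leqP => [lemn|ltnm]; last first.
  rewrite big_nat_cond big1 // => i /andP[/andP[lemi _] /eqP ni].
  by rewrite -ni leqNgt ltnm in lemi.
by rewrite (big_nat_widenl _ 0) // big_mkord (big_pred1 (Ordinal ltnN)) // => i;
  rewrite /= -val_eqE /= eq_sym; case: eqP => // ->.
Qed.

End FpsRing.

Arguments fpsX {R}.

Section FpsUnitRing.
Variable R : comUnitRingType.
Implicit Types a b c : {fps R}.

(* The first n+1 coefficients of the inverse of a, when the constant
   coefficient of a is a unit. *)
Fixpoint fps_inv_seq a (n : nat) : seq R :=
  if n is m.+1 then
    let s := fps_inv_seq a m in
    rcons s (- (fcoef a 0)^-1 * \sum_(i < m.+1) s`_i * fcoef a (m.+1 - i))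
  else [:: (fcoef a 0)^-1].

Definition fps_unit : pred {fps R} := fun a => fcoef a 0 \is a GRing.unit.

(* Following the library convention, non-units are their own inverse. *)
Definition fps_inv a : {fps R} :=
  if fps_unit a then Fps (fun n => (fps_inv_seq a n)`_n) else a.

Let size_inv_seq a n : size (fps_inv_seq a n) = n.+1.
Proof. by elim: n => //= n IHn; rewrite size_rcons IHn. Qed.

Let nth_inv_seq a n i : (i <= n)%N ->
  (fps_inv_seq a n)`_i = (fps_inv_seq a i)`_i.
Proof.
elim: n => [|n IHn]; first by rewrite leqn0 => /eqP->.
rewrite leq_eqVlt => /predU1P[-> //|lt_in].
by rewrite /= nth_rcons size_inv_seq lt_in IHn.
Qed.

Fact fps_mulVx : {in fps_unit, left_inverse 1 fps_inv *%R}.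
Proof.
move=> a Ua; apply/fpsP => n; rewrite fcoefM /fps_inv.
have -> : fps_unit a by [].
case: n => [|n]; first by rewrite big_ord1 /= mulVr.
rewrite big_ord_recr /= subnn nth_rcons size_inv_seq ltnn eqxx.
rewrite mulrAC mulNr mulVr // mulN1r.
apply/eqP; rewrite subr_eq0; apply/eqP; apply: eq_bigr => i _ /=.
by rewrite [in RHS]nth_inv_seq // -ltnS.
Qed.
Fact fps_unitPl a b : b * a = 1 -> fps_unit a.
Proof.
move=> /(congr1 (fun c => fcoef c 0)); rewrite fcoef0M => E.
by apply/unitrPr; exists (fcoef b 0); rewrite mulrC E.
Qed.
Fact fps_inv_out : {in [predC fps_unit], fps_inv =1 id}.
Proof. by move=> a /negPf Ua; rewrite /fps_inv; have -> : fps_unit a = false. Qed.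

HB.instance Definition _ := GRing.ComNzRing_hasMulInverse.Build {fps R}
  fps_mulVx fps_unitPl fps_inv_out.

Lemma fps_unitE a : (a \is a GRing.unit) = (fcoef a 0 \is a GRing.unit).
Proof. by []. Qed.

Lemma fps_unit_1BX k : (1 - fpsX : {fps R}) ^+ k \is a GRing.unit.
Proof. by rewrite unitrX // fps_unitE fcoefB fcoef1 fcoefX subr0 unitr1. Qed.

End FpsUnitRing.

(* Main.v *)
(** Subtracting [q] from every part turns the compositions of [n] into [k] parts
    that are at least [q] into the weak compositions of [n - q * k] into [k]
    parts, which stars and bars counts.  By Pascal's rule, multiplying the series
    with coefficients ['C(n + k, k)] by [1 - x] lowers [k] by one, so this series
    is [(1 - x) ^- k.+1]; shifting it by [q * k] gives the generating function. *)
Require Import Defs.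
From HB Require Import structures.
From mathcomp Require Import all_boot all_order all_algebra.
Import GRing.Theory.
Local Open Scope ring_scope.

Lemma leq_sumn_mem (x : nat) (s : seq nat) : x \in s -> (x <= sumn s)%N.
Proof.
elim: s => //= y s IHs; rewrite inE => /predU1P[->|/IHs]; first exact: leq_addr.
by move/leq_trans; apply; apply: leq_addl.
Qed.

Lemma sumn_map_addn (q : nat) (s : seq nat) :
  sumn (map (addn q) s) = (q * size s + sumn s)%N.
Proof. by elim: s => [|x s IHs] /=; rewrite ?muln0 // IHs mulnS addnACA. Qed.

(** The lower bound on the entries keeps the natural-number subtraction from truncating. *)
Lemma map_addn_subn (q : nat) (s : seq nat) :
  all (leq q) s -> map (addn q) (map (subn^~ q) s) = s.
Proof.
move=> /allP le_qs; rewrite -map_comp -[RHS]map_id; apply/eq_in_map => x /le_qs.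
exact: subnKC.
Qed.

(** By [card_ord_partitions] the binomial counts the tuples with sum [N]. Adding [q] to each entry
    is injective on them, and the image has the same members as the duplicate-free list [l] of
    compositions. *)
Lemma num_compositions_ge_bin (q k n : nat) : (0 < q)%N -> (q * k.+1 <= n)%N ->
  num_compositions_ge q k.+1 n = 'C(n - q * k.+1 + k, k).
Proof.
move=> q_gt0 le_qk_n; set N := (n - q * k.+1)%N.
rewrite addnC -card_ord_partitions.
have [l [uniq_l mem_l ->]] := num_compositions_geP q k.+1 n.
set B := [set t : k.+1.-tuple 'I_N.+1 | (\sum_(i <- t) i == N)%N].
have sumB (t : k.+1.-tuple 'I_N.+1) : (t \in B) = (sumn (map val t) == N).
  by rewrite inE sumnE big_map.
pose shift (t : k.+1.-tuple 'I_N.+1) := map (addn q) (map val t).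
have shift_inj : injective shift.
  by move=> t1 t2 /(inj_map (@addnI q))/(inj_map val_inj)/val_inj.
rewrite cardE -(size_map shift); apply/perm_size/uniq_perm => //.
  by rewrite map_inj_uniq ?enum_uniq.
move=> s; rewrite mem_l; apply/andP/mapP => [[/and3P[/eqP sz_s _ /eqP sum_s] q_s]|].
  have sE := map_addn_subn _ _ q_s; set r := map (subn^~ q) s in sE.
  have sz_r : size r = k.+1 by rewrite size_map.
  have sum_r : sumn r = N by rewrite /N -sum_s -sE sumn_map_addn sz_r addKn.
  (* An entry of [r] is at most the sum [N], so [inord] does not alter it. *)
  have rE : map val (map (@inord N) r) = r.
    rewrite -map_comp -[RHS]map_id; apply/eq_in_map => x /(leq_sumn_mem _ _) le_x /=.
    by rewrite inordK // ltnS -sum_r.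
  have sz_t : size (map (@inord N) r) == k.+1 by rewrite size_map sz_r.
  exists (Tuple sz_t); first by rewrite mem_enum sumB /= rE sum_r.
  by rewrite /shift /= rE sE.
move=> [t]; rewrite mem_enum sumB => /eqP sum_t ->.
have q_t : all (leq q) (shift t) by apply/allP => _ /mapP[x _ ->]; apply: leq_addr.
split=> //; apply/and3P; split; first by rewrite !size_map size_tuple.
  (* Parts are positive because [0 < q]. *)
  by apply: sub_all q_t => x; apply: leq_trans.
by rewrite sumn_map_addn size_map size_tuple sum_t subnKC.
Qed.

(** A listed composition would have sum [q * k] plus the sum of its reduced parts, so the list is
    empty. *)
Lemma num_compositions_ge_small (q k n : nat) :
  (n < q * k)%N -> num_compositions_ge q k n = 0%N.
Proof.
have [l [_ mem_l ->]] := num_compositions_geP q k n.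
case: l mem_l => // s l /(_ s); rewrite mem_head.
move=> /esym/andP[/and3P[/eqP <- _ /eqP <-] /(map_addn_subn _ _) {1 3}<-].
by rewrite sumn_map_addn size_map ltnNge leq_addr.
Qed.

Lemma fcoefXnM (R : comNzRingType) (m n : nat) (a : {fps R}) :
  fcoef (fpsX ^+ m * a) n = if (m <= n)%N then fcoef a (n - m) else 0.
Proof.
elim: m n => [|m IHm] n; first by rewrite mul1r subn0.
by rewrite exprS -mulrA fcoefXM; case: n => [|n] //; rewrite IHm.
Qed.

(** The product form makes sense over rings without a chosen inverse. *)
Lemma fps_geometricX (R : comNzRingType) (k : nat) :
  (1 - fpsX) ^+ k.+1 * Fps (fun n => 'C(n + k, k)%:R) = 1 :> {fps R}.
Proof.
elim: k => [|k IHk].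
  (* For [k = 0] all coefficients are 1, and each one after the first cancels against its
     predecessor. *)
  apply/fpsP => n; rewrite expr1 mulrBl mul1r fcoefB fcoefXM fcoef1.
  by case: n => [|n]; rewrite /= !bin0 ?subr0 ?subrr.
(* One factor [1 - fpsX] is absorbed into the series; it remains to recover the series for [k]. *)
rewrite exprSr -mulrA -[RHS]IHk; congr (_ * _).
apply/fpsP => n; rewrite mulrBl mul1r fcoefB fcoefXM.
case: n => [|n] /=; first by rewrite !add0n !binn subr0.
by rewrite addnS binS addSnnS natrD addrAC subrr add0r.
Qed.

Theorem theorem13 (q k : nat) (hq : (0 < q)%N) (hk : (0 < k)%N) :
  (forall n : nat, (0 < n)%N ->
     ((q * k <= n)%N ->
        num_compositions_ge q k n = 'C(n - q * k + k - 1, k - 1)) /\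
     ((n < q * k)%N -> num_compositions_ge q k n = 0%N)) /\
  fps_sum_from (q * k)%N (fun n => (num_compositions_ge q k n)%:Z)
    = fpsX ^+ (q * k)%N / (1 - fpsX) ^+ k :> {fps int}.
Proof.
case: k hk => // k _; split=> [n _|].
  split=> [le_qk_n|]; last exact: num_compositions_ge_small.
  by rewrite num_compositions_ge_bin // addnS !subn1.
transitivity (fpsX ^+ (q * k.+1)%N * Fps (fun n => 'C(n + k, k)%:R) : {fps int}).
  (* Below degree [q * k.+1] both coefficients are 0. *)
  apply/fpsP => n; rewrite fcoefXnM /=; case: ifP => // le_qk_n.
  by rewrite num_compositions_ge_bin // natz.
(* The denominator is a unit, so it can be moved to the other side. *)
apply: (canRL (mulrK (fps_unit_1BX int k.+1))).
by rewrite -mulrA [X in _ * X = _]mulrC fps_geometricX mulr1.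
Qed.
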